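(* Let $M\models\mathsf{ZF}$ be $\beta$-$(\mathsf{GB}+\mathsf{ETR})$-realizable. Then $M$ has a minimum $\beta$-$(\mathsf{GB}+\mathsf{ETR})$-realization, i.e. a $\beta$-$(\mathsf{GB}+\mathsf{ETR})$-realization contained in every $\beta$-$(\mathsf{GB}+\mathsf{ETR})$-realization for $M$. Moreover, if $M$ has a global well-order first-order definable over $M$ with set parameters, then this minimum $\beta$-$(\mathsf{GB}+\mathsf{ETR})$-realization satisfies Global Choice.
   Context: Models of second-order set theory are pairs $(M,\mathcal X)$ with $\mathcal X\subseteq\mathcal P(M)$. $\mathsf{GB}$ consists of $\mathsf{ZF}$, Extensionality for classes, Class Replacement, Elementary Comprehension (comprehension for formulas without class quantifiers, with set and class parameters). Global Choice: there is a class bijection between $V$ and $\mathrm{Ord}$. $\mathsf{ETR}$: for every first-order $\varphi(x,Y,A)$ with class parameter $A$ and every well-founded class relation $R$ there is a class $S\subseteq\mathrm{dom}R\times V$ with $S_r=\{x:\varphi(x,S\restriction r,A)\}$ for all $r\in\mathrm{dom}R$, where $S_r=\{x:(r,x)\in S\}$, $S\restriction r=S\cap(\{r':r'<_Rr\}\times V)$, $<_R$ the transitive closure of $R$. A $\beta$-model is an $(M,\mathcal X)$ with $M$ transitive (true $\in$) such that every $R\in\mathcal X$ that $(M,\mathcal X)$ thinks is well-founded is truly well-founded. $\mathcal X$ is a $\beta$-$T$-realization for $M$ if $(M,\mathcal X)\models T$ is a $\beta$-model; $M$ is $\beta$-$T$-realizable if such $\mathcal X$ exists. *)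

(* Defs.v *)
From HB Require Import structures.
From mathcomp Require Import all_boot.
From mathcomp Require Import boolp classical_sets.

Set Implicit Arguments.
Unset Strict Implicit.
Unset Printing Implicit Defensive.

Local Open Scope classical_set_scope.
Local Open Scope quotient_scope.

(** * The ambient universe of sets

    Aczel trees modulo bisimulation.  On the quotient [V], Leibniz equality is
    extensional equality of sets. *)

Inductive tree : Type := Tree (A : Type) (f : A -> tree).

Fixpoint bisim (s t : tree) : Prop :=
  let: Tree A f := s in let: Tree B g := t in
  (forall a, exists b, bisim (f a) (g b)) /\
  (forall b, exists a, bisim (f a) (g b)).

Definition tree_mem (s t : tree) : Prop :=
  let: Tree B g := t in exists b, bisim s (g b).

Lemma bisim_refl s : bisim s s.
Proof. by elim: s => A f IH /=; split=> a; exists a. Qed.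

Lemma bisim_sym s t : bisim s t -> bisim t s.
Proof.
elim: s t => A f IH [B g] /= [fg gf]; split=> [b|a].
  by have [a /IH] := gf b; exists a.
by have [b /IH] := fg a; exists b.
Qed.

Lemma bisim_trans s t u : bisim s t -> bisim t u -> bisim s u.
Proof.
elim: s t u => A f IH [B g] [C h] /= [fg gf] [gh hg]; split=> [a|c].
  by have [b /IH ab] := fg a; have [c /ab] := gh b; exists c.
by have [b bc] := hg c; have [a /IH ab] := gf b; exists a; apply: ab bc.
Qed.

HB.instance Definition _ := gen_eqMixin tree.
HB.instance Definition _ := gen_choiceMixin tree.

Definition bisimb (s t : tree) : bool := `[< bisim s t >].

Lemma bisimb_refl : reflexive bisimb.
Proof. by move=> s; apply/asboolP/bisim_refl. Qed.

Lemma bisimb_sym : symmetric bisimb.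
Proof. by move=> s t; apply/asboolP/asboolP => /bisim_sym. Qed.

Lemma bisimb_trans : transitive bisimb.
Proof.
by move=> t s u /asboolP st /asboolP tu; apply/asboolP; apply: bisim_trans tu.
Qed.

Canonical bisim_equiv := EquivRel bisimb bisimb_refl bisimb_sym bisimb_trans.

Definition V : Type := {eq_quot bisim_equiv}.

Definition vmem (x y : V) : Prop :=
  tree_mem (repr (x : {eq_quot bisim_equiv}))
           (repr (y : {eq_quot bisim_equiv})).

Definition vset (t : tree) : V := \pi_({eq_quot bisim_equiv}) t.

Lemma vset_eqP s t : vset s = vset t <-> bisim s t.
Proof.
split=> [/eqP|st]; first by rewrite eqmodE => /asboolP.
by apply/eqP; rewrite eqmodE; apply/asboolP.
Qed.

Lemma vset_repr (x : V) : vset (repr (x : {eq_quot bisim_equiv})) = x.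
Proof. exact: reprK. Qed.

Lemma tree_mem_bisim s s' t t' :
  bisim s s' -> bisim t t' -> tree_mem s t -> tree_mem s' t'.
Proof.
case: t t' => [B g] [B' g'] ss' /= [gg' _] [b sb].
have [b' bb'] := gg' b; exists b'.
exact: bisim_trans (bisim_sym ss') (bisim_trans sb bb').
Qed.

Lemma vmem_vset s t : vmem (vset s) (vset t) <-> tree_mem s t.
Proof.
have rep u : bisim (repr (vset u : {eq_quot bisim_equiv})) u.
  by apply/vset_eqP; rewrite vset_repr.
split; apply: tree_mem_bisim; try exact: rep; exact/bisim_sym/rep.
Qed.

Lemma V_ext (x y : V) : (forall z, vmem z x <-> vmem z y) -> x = y.
Proof.
rewrite -(vset_repr x) -(vset_repr y).
case: (repr _) => A f; case: (repr _) => B g xy; apply/vset_eqP; split=> [a|b].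
  have /vmem_vset[b ab] : vmem (vset (f a)) (vset (Tree g)).
    by apply/xy/vmem_vset; exists a; apply: bisim_refl.
  by exists b.
have /vmem_vset[a ba] : vmem (vset (g b)) (vset (Tree f)).
  by apply/xy/vmem_vset; exists b; apply: bisim_refl.
by exists a; apply: bisim_sym.
Qed.

(** * First-order formulas

    [formula K W] is the type of formulas of the language of set theory, without
    class quantifiers, whose free set variables are in [W] and whose class
    parameters are in [K].  Under a quantifier, [None] is the bound variable. *)

Inductive formula (K W : Type) : Type :=
| Equal of W & W
| Mem of W & W
| MemClass of W & K
| Not of formula K W
| And of formula K W & formula K W
| All of formula K (option W).

Definition scons (W D : Type) (a : D) (e : W -> D) (v : option W) : D :=
  if v is Some w then e w else a.

Fixpoint sat (D : Type) (E : D -> D -> Prop) (K W : Type) (phi : formula K W)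
    (C : K -> set D) (e : W -> D) {struct phi} : Prop :=
  match phi with
  | Equal x y => e x = e y
  | Mem x y => E (e x) (e y)
  | MemClass x Y => C Y (e x)
  | Not psi => ~ sat E psi C e
  | And psi chi => sat E psi C e /\ sat E chi C e
  | All psi => forall a, sat E psi C (scons a e)
  end.

Definition no_class (D : Type) (k : void) : set D := match k with end.

(** * Set theory in a structure [(D, E)] *)

Section SetTheory.
Variables (D : Type) (E : D -> D -> Prop).

Definition is_upair (a b c : D) : Prop := forall x, E x c <-> x = a \/ x = b.

Definition is_opair (a b c : D) : Prop :=
  exists s d, [/\ is_upair a a s, is_upair a b d & is_upair s d c].

(* Trichotomy suffices for being well-ordered by membership, in the presence of
   Foundation. *)
Definition is_ordinal (a : D) : Prop :=
  (forall x y, E y a -> E x y -> E x a) /\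
  (forall x y, E x a -> E y a -> [\/ E x y, x = y | E y x]).

Definition Extensionality : Prop :=
  forall a b, (forall x, E x a <-> E x b) -> a = b.

Definition Foundation : Prop :=
  forall a, (exists x, E x a) -> exists2 x, E x a & forall y, E y a -> ~ E y x.

Definition Pairing : Prop := forall a b, exists c, is_upair a b c.

Definition Union : Prop :=
  forall a, exists u, forall x, E x u <-> exists2 y, E y a & E x y.

Definition Powerset : Prop :=
  forall a, exists p, forall x, E x p <-> (forall z, E z x -> E z a).

Definition Infinity : Prop :=
  exists w, (exists2 x, E x w & forall z, ~ E z x) /\
    (forall x, E x w -> exists2 y, E y w & forall z, E z y <-> E z x \/ z = x).

Definition Separation : Prop :=
  forall n (phi : formula void (option 'I_n)) (p : 'I_n -> D) (a : D),
  exists b, forall x, E x b <-> E x a /\ sat E phi (@no_class D) (scons x p).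

Definition Replacement : Prop :=
  forall n (phi : formula void (option (option 'I_n))) (p : 'I_n -> D) (a : D),
  let F x y := sat E phi (@no_class D) (scons y (scons x p)) in
  (forall x y y', E x a -> F x y -> F x y' -> y = y') ->
  exists b, forall y, E y b <-> exists2 x, E x a & F x y.

Definition ZF : Prop :=
  [/\ Extensionality, Foundation, Pairing & Union] /\
  [/\ Powerset, Infinity, Separation & Replacement].

(* "Well-order" is meant in the sense of the structure: nonempty sets have least
   elements.  Over ZF, this implies the same for nonempty definable classes. *)
Definition definable_global_wellorder : Prop :=
  exists n (phi : formula void (option (option 'I_n))) (p : 'I_n -> D),
  let lt x y := sat E phi (@no_class D) (scons y (scons x p)) in
  [/\ forall x, ~ lt x x,
      forall x y z, lt x y -> lt y z -> lt x z,
      forall x y, [\/ lt x y, x = y | lt y x] &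
      forall a, (exists x, E x a) ->
        exists2 x, E x a & forall y, E y a -> x = y \/ lt x y].

(** Class relations are classes of Kuratowski pairs; [(a, b)] in [R] is read
    [a R b], so that [a] is the smaller element when [R] is well-founded. *)

Definition rel_of (R : set D) (a b : D) : Prop :=
  exists2 c, is_opair a b c & R c.

Definition class_relation (R : set D) : Prop :=
  forall c, R c -> exists a b, is_opair a b c.

(* The underlying domain of [R], including its maximal elements. *)
Definition dom (R : set D) : set D :=
  [set r | exists s, rel_of R r s \/ rel_of R s r].

Definition slice (S : set D) (r : D) : set D := [set x | rel_of S r x].

Section Classes.
Variable X : set (set D).

Definition wellfounded (R : set D) : Prop :=
  class_relation R /\
  forall C, X C -> C !=set0 -> exists2 a, C a & forall b, C b -> ~ rel_of R b a.

(* The least transitive relation containing [R], as computed in the model; if the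
   model satisfies GB, then this is one of its classes. *)
Definition trans_closure (R : set D) (a b : D) : Prop :=
  forall T, X T -> class_relation T ->
  (forall x y z, rel_of T x y -> rel_of T y z -> rel_of T x z) ->
  R `<=` T -> rel_of T a b.

Definition restr (R S : set D) (r : D) : set D :=
  [set c | S c /\ exists r' x, is_opair r' x c /\ trans_closure R r' r].

Definition ClassExtensionality : Prop :=
  forall A B, X A -> X B -> (forall x, A x <-> B x) -> A = B.

Definition ClassReplacement : Prop :=
  forall F, X F -> (forall x y y', rel_of F x y -> rel_of F x y' -> y = y') ->
  forall a, exists b, forall y, E y b <-> exists2 x, E x a & rel_of F x y.

Definition ElementaryComprehension : Prop :=
  forall k n (phi : formula 'I_k (option 'I_n)) (C : 'I_k -> set D)
    (p : 'I_n -> D),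
  (forall i, X (C i)) -> X [set x | sat E phi C (scons x p)].

Definition GB : Prop :=
  [/\ ZF, ClassExtensionality, ClassReplacement & ElementaryComprehension].

(* In [phi(x, Y, A)], the class variables [Y] and [A] are [true] and [false]. *)
Definition ETR : Prop :=
  forall (phi : formula bool unit) (A R : set D),
  X A -> X R -> wellfounded R ->
  exists2 S, X S &
    (forall c, S c -> exists r x, is_opair r x c /\ dom R r) /\
    (forall r, dom R r ->
       slice S r = [set x | sat E phi (fun Y => if Y then restr R S r else A)
                                  (fun _ => x)]).

Definition GB_ETR : Prop := GB /\ ETR.

Definition GlobalChoice : Prop :=
  exists2 F, X F &
    [/\ class_relation F,
        forall x a, rel_of F x a -> is_ordinal a,
        forall x, exists! a, rel_of F x a &
        forall a, is_ordinal a -> exists! x, rel_of F x a].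

End Classes.
End SetTheory.

(** * Beta-models *)

Definition elts (M : V) : Type := {x : V | vmem x M}.

Definition Emem (M : V) (x y : elts M) : Prop := vmem (sval x) (sval y).
Arguments Emem : clear implicits.

Definition transitive_set (M : V) : Prop :=
  forall x y, vmem x y -> vmem y M -> vmem x M.

Definition second_order_theory : Type :=
  forall D : Type, (D -> D -> Prop) -> set (set D) -> Prop.

Definition beta_model (M : V) (X : set (set (elts M))) : Prop :=
  transitive_set M /\
  forall R, X R -> wellfounded (Emem M) X R -> wellfounded (Emem M) setT R.

Definition beta_realization (T : second_order_theory) (M : V)
    (X : set (set (elts M))) : Prop :=
  T (elts M) (Emem M) X /\ beta_model X.

Definition beta_realizable (T : second_order_theory) (M : V) : Prop :=
  exists X : set (set (elts M)), beta_realization T X.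

(* Main.v *)
Require Import Defs.
From mathcomp Require Import all_boot.
From mathcomp Require Import boolp classical_sets.
From Stdlib Require Import Relations Wellfounded.

(** The minimum realization is the intersection [X0] of all beta-realizations.
    GB passes to the intersection at once; the point is that well-foundedness
    of a class relation does not depend on the realization.  Indeed, ETR along
    membership provides ranks, and a second recursion closes a point of a class
    without [R]-minimal elements under least-rank [R]-predecessors; so [R] is
    well-founded as soon as every nonempty *set* has an [R]-minimal element.
    Hence a relation that [X0] thinks well-founded is truly well-founded, and
    the solution of a recursion along it, being unique, is common to all
    realizations.  The transitive closure used in ETR is realization-independent
    too, being first-order definable from [R].  For Global Choice, order the
    universe by rank first and by the given well-order second, and collapse. *)

Set Implicit Arguments.

Local Open Scope classical_set_scope.

(** * Renaming of variables and finite support of formulas *)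

Section Renaming.

Fixpoint frename (K K' W W' : Type) (f : K -> K') (g : W -> W')
    (phi : formula K W) : formula K' W' :=
  match phi with
  | Equal x y => Equal _ (g x) (g y)
  | Defs.Mem x y => Defs.Mem _ (g x) (g y)
  | MemClass x A => MemClass (g x) (f A)
  | Not psi => Not (frename f g psi)
  | And psi chi => And (frename f g psi) (frename f g chi)
  | All psi => All (frename f (omap g) psi)
  end.

Lemma sat_frename (D : Type) (E : D -> D -> Prop) (K K' W W' : Type)
    (f : K -> K') (g : W -> W') (phi : formula K W) (C : K' -> set D)
    (e : W' -> D) :
  sat E (frename f g phi) C e <-> sat E phi (C \o f) (e \o g).
Proof.
elim: phi W' g e => {W} [W x y|W x y|W x A|W p IH|W p IHp q IHq|W p IH] W' g e //=.
- by split=> np /IH.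
- by split=> -[/IHp ? /IHq].
- have scg a : scons a e \o omap g = scons a (e \o g) by apply: funext => -[].
  by split=> h a; [rewrite -scg; apply/IH | apply/IH; rewrite scg].
Qed.

Lemma frename_comp (K1 K2 K3 W1 W2 W3 : Type) (f : K1 -> K2) (f' : K2 -> K3)
    (g : W1 -> W2) (g' : W2 -> W3) (phi : formula K1 W1) :
  frename f' g' (frename f g phi) = frename (f' \o f) (g' \o g) phi.
Proof.
elim: phi W2 W3 g g' => {W1} [W x y|W x y|W x A|W p IH|W p IHp q IHq|W p IH]
  W2 W3 g g' //=; rewrite ?IH ?IHp ?IHq //.
by congr (All (frename _ _ _)); apply: funext => -[].
Qed.

(** Elementary Comprehension takes parameters indexed by ['I_k] and ['I_n], whereas the formulas
    built below use arbitrary types of parameters. The element [w0] covers the case in which a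
    quantifier leaves an index without a free variable to name. *)
Lemma formula_finite_support (K W : Type) (w0 : W) (phi : formula K W) :
  exists k n (psi : formula 'I_k 'I_n) f g, phi = frename f g psi.
Proof.
have merge (T : Type) n1 n2 (g1 : 'I_n1 -> T) (g2 : 'I_n2 -> T) :
    exists g : 'I_(n1 + n2) -> T,
      g \o @lshift n1 n2 = g1 /\ g \o @rshift n1 n2 = g2.
  exists (fun i => match split i with inl a => g1 a | inr b => g2 b end).
  by split; apply: funext => i /=; [rewrite (unsplitK (inl i)) | rewrite (unsplitK (inr i))].
elim: phi w0 => {W} [W x y|W x y|W x A|W p IH|W p IHp q IHq|W p IH] w0.
- have [g [g1 g2]] := merge _ _ _ (fun _ : 'I_1 => x) (fun _ : 'I_1 => y).
  exists 0, (1 + 1)%N, (Equal _ (lshift 1 ord0) (rshift 1 ord0)).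
  exists (fun i : 'I_0 => False_rect K (notF (ltn_ord i))), g => /=.
  by congr Equal; [have := congr1 (@^~ ord0) g1 | have := congr1 (@^~ ord0) g2].
- have [g [g1 g2]] := merge _ _ _ (fun _ : 'I_1 => x) (fun _ : 'I_1 => y).
  exists 0, (1 + 1)%N, (Defs.Mem _ (lshift 1 ord0) (rshift 1 ord0)).
  exists (fun i : 'I_0 => False_rect K (notF (ltn_ord i))), g => /=.
  by congr Defs.Mem; [have := congr1 (@^~ ord0) g1 | have := congr1 (@^~ ord0) g2].
- by exists 1, 1, (MemClass ord0 ord0), (fun=> A), (fun=> x).
- have [k [n [psi [f [g ->]]]]] := IH w0.
  by exists k, n, (Not psi), f, g.
- have [k1 [n1 [p' [f1 [g1 ->]]]]] := IHp w0.
  have [k2 [n2 [q' [f2 [g2 ->]]]]] := IHq w0.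
  have [f [fl fr]] := merge _ _ _ f1 f2; have [g [gl gr]] := merge _ _ _ g1 g2.
  exists (k1 + k2)%N, (n1 + n2)%N.
  exists (And (frename (@lshift k1 k2) (@lshift n1 n2) p')
              (frename (@rshift k1 k2) (@rshift n1 n2) q')), f, g.
  by rewrite /= !frename_comp fl fr gl gr.
- have [k [n [psi [f [g ->]]]]] := IH (Some w0).
  (* All indices that [g] sends to [None] become the bound variable; they are no longer free, so
     their value [w0] is harmless. *)
  exists k, n, (All (frename id (fun i => if g i is Some _ then Some i else None) psi)).
  exists f, (fun i => odflt w0 (g i)); rewrite /= frename_comp.
  congr (All (frename _ _ _)); apply: funext => i /=.
  by case gi: (g i) => [w|] //=; rewrite gi.
Qed.

End Renaming.

(** * A calculus of definable predicates *)

(* [Gamma i] interprets the class parameters and [pv] the set parameters; a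
   predicate is definable by one formula uniformly in [i]. *)
Section Definability.
Variables (D : Type) (E : D -> D -> Prop) (K I Pt : Type).
Variables (Gamma : I -> K -> set D) (pv : Pt -> D).

Definition venv (W : Type) (e : W -> D) (v : W + Pt) : D :=
  match v with inl w => e w | inr p => pv p end.

Definition definable (W : Type) (P : I -> (W -> D) -> Prop) : Prop :=
  exists phi : formula K (W + Pt),
    forall i e, P i e <-> sat E phi (Gamma i) (venv e).

Definition term (W : Type) (t : (W -> D) -> D) : Prop :=
  exists v : W + Pt, forall e, t e = venv e v.

Definition cterm (A : I -> set D) : Prop := exists k, forall i, A i = Gamma i k.

Lemma term_var (W : Type) (w : W) : term (fun e => e w).
Proof. by exists (inl w). Qed.

Lemma def_eq (W : Type) (s t : (W -> D) -> D) :
  term s -> term t -> definable (fun i e => s e = t e).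
Proof. by move=> [v vE] [w wE]; exists (Equal _ v w) => i e /=; rewrite vE wE. Qed.

Lemma def_mem (W : Type) (s t : (W -> D) -> D) :
  term s -> term t -> definable (fun i e => E (s e) (t e)).
Proof. by move=> [v vE] [w wE]; exists (Defs.Mem _ v w) => i e /=; rewrite vE wE. Qed.

Lemma def_class (W : Type) (A : I -> set D) (t : (W -> D) -> D) :
  cterm A -> term t -> definable (fun i e => A i (t e)).
Proof. by move=> [k kE] [w wE]; exists (MemClass w k) => i e /=; rewrite kE wE. Qed.

Lemma def_not (W : Type) (P : I -> (W -> D) -> Prop) :
  definable P -> definable (fun i e => ~ P i e).
Proof. by move=> [p pE]; exists (Not p) => i e /=; split=> + /pE. Qed.

Lemma def_and (W : Type) (P Q : I -> (W -> D) -> Prop) :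
  definable P -> definable Q -> definable (fun i e => P i e /\ Q i e).
Proof.
by move=> [p pE] [q qE]; exists (And p q) => i e /=; split=> -[/pE ? /qE ?].
Qed.

Lemma def_iff (W : Type) (P Q : I -> (W -> D) -> Prop) :
  (forall i e, P i e <-> Q i e) -> definable Q -> definable P.
Proof. by move=> PQ [p pE]; exists p => i e; apply: (iff_trans (PQ i e)). Qed.

Lemma def_imp (W : Type) (P Q : I -> (W -> D) -> Prop) :
  definable P -> definable Q -> definable (fun i e => P i e -> Q i e).
Proof.
move=> dP dQ; apply: def_iff (def_not (def_and dP (def_not dQ))) => i e.
split=> [PQ [/PQ] //|nPQ p]; apply: contrapT => nq; exact: nPQ.
Qed.

Lemma def_or (W : Type) (P Q : I -> (W -> D) -> Prop) :
  definable P -> definable Q -> definable (fun i e => P i e \/ Q i e).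
Proof.
move=> dP dQ; apply: def_iff (def_imp (def_not dP) dQ) => i e.
split=> [[p /(_ p)|q _]|nPQ] //; have [p|/nPQ] := EM (P i e); by [left|right].
Qed.

Lemma def_equiv (W : Type) (P Q : I -> (W -> D) -> Prop) :
  definable P -> definable Q -> definable (fun i e => P i e <-> Q i e).
Proof. by move=> dP dQ; apply: def_and; apply: def_imp. Qed.

Lemma def_all (W : Type) (P : I -> (W -> D) -> D -> Prop) :
  definable (fun i (e : option W -> D) => P i (fun w => e (Some w)) (e None)) ->
  definable (fun i e => forall a, P i e a).
Proof.
move=> [p pE].
pose h (v : option W + Pt) : option (W + Pt) :=
  match v with inl None => None | inl (Some w) => Some (inl w)
             | inr c => Some (inr c) end.
exists (All (frename id h p)) => i e /=.
have hE a : scons a (venv e) \o h = venv (scons a e).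
  by apply: funext => -[[w|]|c].
split=> [Pe a|Pe a].
  by apply/sat_frename; rewrite hE; apply/pE; exact: Pe.
by have /sat_frename := Pe a; rewrite hE => /pE.
Qed.

Lemma def_ex (W : Type) (P : I -> (W -> D) -> D -> Prop) :
  definable (fun i (e : option W -> D) => P i (fun w => e (Some w)) (e None)) ->
  definable (fun i e => exists a, P i e a).
Proof.
move=> dP.
apply: def_iff (def_not (def_all (fun i e a => ~ P i e a) (def_not dP))) => i e.
split=> [[a Pa] /(_ a)|] // nP.
by apply: contrapT => nex; apply: nP => a Pa; apply: nex; exists a.
Qed.

Lemma def_ex2 (W : Type) (P Q : I -> (W -> D) -> D -> Prop) :
  definable (fun i (e : option W -> D) => P i (fun w => e (Some w)) (e None)) ->
  definable (fun i (e : option W -> D) => Q i (fun w => e (Some w)) (e None)) ->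
  definable (fun i e => exists2 a, P i e a & Q i e a).
Proof.
move=> dP dQ.
apply: def_iff (def_ex (fun i e a => P i e a /\ Q i e a) (def_and dP dQ)) => i e.
by split=> [[a ? ?]|[a []]]; exists a.
Qed.

Lemma term_some (W : Type) (t : (W -> D) -> D) :
  term t -> term (fun e : option W -> D => t (fun w => e (Some w))).
Proof.
by move=> [[w|p] tE]; [exists (inl (Some w)) | exists (inr p)] => e; rewrite tE.
Qed.

Lemma def_upair (W : Type) (s t u : (W -> D) -> D) :
  term s -> term t -> term u ->
  definable (fun i e => is_upair E (s e) (t e) (u e)).
Proof.
move=> /term_some ts /term_some tt /term_some tu; rewrite /is_upair.
by apply: def_all; apply: def_equiv;
  [apply: def_mem | apply: def_or; apply: def_eq] => //; apply: term_var.
Qed.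

Lemma def_opair (W : Type) (s t u : (W -> D) -> D) :
  term s -> term t -> term u ->
  definable (fun i e => is_opair E (s e) (t e) (u e)).
Proof.
move=> ts tt tu.
apply: (@def_iff _ _ (fun i e => exists x y, is_upair E (s e) (s e) x /\
   (is_upair E (s e) (t e) y /\ is_upair E x y (u e)))) => [i e|].
  split=> [[x [y []]]|[x [y [? []]]]]; first by exists x, y.
  by exists x, y; split.
apply: def_ex; apply: def_ex.
have := term_some (term_some ts); have := term_some (term_some tt).
have := term_some (term_some tu); move=> ? ? ?.
by apply: def_and; [|apply: def_and]; apply: def_upair => //;
  try exact: term_var; apply: (term_some (t := fun e => e None)); apply: term_var.
Qed.

Lemma def_rel_of (W : Type) (A : I -> set D) (s t : (W -> D) -> D) :
  cterm A -> term s -> term t ->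
  definable (fun i e => rel_of E (A i) (s e) (t e)).
Proof.
move=> cA /term_some ts /term_some tt.
apply: def_ex2; last by apply: def_class => //; apply: term_var.
by apply: def_opair => //; apply: term_var.
Qed.

End Definability.

Lemma term_cst (D W : Type) (d : D) : @term D D id W (fun=> d).
Proof. by exists (inr d). Qed.

(** Every class in [X] and every element of [D] is a parameter naming itself, which spares any
    bookkeeping of parameter tuples. *)
Definition Xdefinable (D : Type) (E : D -> D -> Prop) (X : set (set D))
    (W : Type) (P : unit -> (W -> D) -> Prop) : Prop :=
  @definable D E {A | X A} unit D (fun=> @sval _ _) id W P.

Lemma X_cterm (D : Type) (X : set (set D)) (A : set D) :
  X A -> cterm (fun=> @sval _ X) (fun _ : unit => A).
Proof. by move=> XA; exists (exist _ A XA). Qed.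

(* The two class variables of the formulas in [ETR]. *)
Definition etr_env (D : Type) (A Y : set D) (b : bool) : set D :=
  if b then Y else A.

Lemma etr_cterm_rec (D : Type) (A : set D) : cterm (etr_env A) id.
Proof. by exists true. Qed.

Lemma etr_cterm_par (D : Type) (A : set D) : cterm (etr_env A) (fun=> A).
Proof. by exists false. Qed.

(** The order matters: named relations, [<->] and [~] are tried before the constructions that they
    unfold to, and [def_class], with its very flexible pattern, comes last. *)
Ltac definable_step :=
  cbn beta; first
  [ assumption
  | apply term_var | apply term_cst
  | apply X_cterm; assumption | apply etr_cterm_rec | apply etr_cterm_par
  | apply def_rel_of | apply def_opair | apply def_upair
  | apply def_equiv | apply def_and | apply def_or
  | apply def_ex2 | apply def_ex | apply def_all
  | apply def_eq | apply def_mem | apply def_not | apply def_imp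
  | apply def_class ].

Ltac definability := rewrite /Xdefinable; repeat definable_step.

(** * Pairs, relations and sets in a model of GB *)

Section GodelBernays.
Variables (D : Type) (E : D -> D -> Prop) (X : set (set D)).
Hypothesis gb : GB E X.

Lemma comprehension (P : set D) :
  Xdefinable E X (fun _ (e : unit -> D) => P (e tt)) -> X P.
Proof.
(* The set [d0] given by Infinity is a default value for the indices that stand for the free
   variable instead of a parameter. *)
have [[_ [_ [d0 _] _ _]] _ _ ec] := gb.
move=> [phi phiE].
pose h (v : unit + D) := match v with inl _ => None | inr d => Some d end.
have [k [n [psi [f [g psiE]]]]] :=
  formula_finite_support (None : option D) (frename id h phi).
pose h' i := if g i is Some _ then Some i else None.
pose p i := odflt d0 (g i).
suff -> : P = [set x | sat E (frename id h' psi) (sval \o f) (scons x p)].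
  by apply: ec => i; apply: svalP.
have h'E x : scons x p \o h' = scons x id \o g.
  apply: funext => i; rewrite /= /h' /p.
  by case gi: (g i) => [w|] //=; rewrite gi.
have hE x : scons x id \o h = venv id (fun=> x) by apply: funext => -[[]|].
apply/seteqP; split=> x /=.
  move=> /(phiE tt (fun=> x)) sx; apply/sat_frename; rewrite h'E.
  by apply/(sat_frename E f g psi sval); rewrite -psiE; apply/sat_frename; rewrite hE.
move=> /sat_frename; rewrite h'E => /(sat_frename E f g psi sval).
by rewrite -psiE => /sat_frename; rewrite hE => /(phiE tt (fun=> x)).
Qed.

Lemma upair_fun a b c c' : is_upair E a b c -> is_upair E a b c' -> c = c'.
Proof.
have [[[ext _ _ _] _] _ _ _] := gb.
by move=> h h'; apply: ext => x; split=> [/h/h'|/h'/h].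
Qed.

Lemma opair_fun a b c c' : is_opair E a b c -> is_opair E a b c' -> c = c'.
Proof.
move=> [s [d [hs hd hc]]] [s' [d' [hs' hd' hc']]].
by apply: upair_fun hc _; rewrite (upair_fun hs hs') (upair_fun hd hd').
Qed.

Lemma opair_ex a b : exists c, is_opair E a b c.
Proof.
have [[[_ _ pairing _] _] _ _ _] := gb.
have [s hs] := pairing a a; have [d hd] := pairing a b.
by have [c hc] := pairing s d; exists c, s, d.
Qed.

Lemma opair_inj a b a' b' c :
  is_opair E a b c -> is_opair E a' b' c -> a = a' /\ b = b'.
Proof.
move=> [s [d [hs hd hc]]] [s' [d' [hs' hd' hc']]].
have aa' : a = a'.
  have /hc s'c : E s' c by apply/hc'; left.
  have /hs' : E a s' by case: s'c => ->; [apply/hs | apply/hd]; left.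
  by case.
subst a'; split=> //.
have b_or : b = a \/ b = b'.
  have /hc' dc : E d c by apply/hc; right.
  have : E b d by apply/hd; right.
  by case: dc => -> => [/hs'[]|/hd']; [left|left|].
have b'_or : b' = a \/ b' = b.
  have /hc d'c : E d' c by apply/hc'; right.
  have : E b' d' by apply/hd'; right.
  by case: d'c => -> => [/hs[]|/hd]; [left|left|].
by case: b_or b'_or => -> // [] ->.
Qed.

Definition mkrel (Q : D -> D -> Prop) : set D :=
  [set c | exists a b, is_opair E a b c /\ Q a b].

Lemma rel_mkrel (Q : D -> D -> Prop) a b : rel_of E (mkrel Q) a b <-> Q a b.
Proof.
split=> [[c hc [a' [b' [hc' q]]]]|q].
  by have [-> ->] := opair_inj hc hc'.
by have [c hc] := opair_ex a b; exists c => //; exists a, b.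
Qed.

Lemma mkrel_relation (Q : D -> D -> Prop) : class_relation E (mkrel Q).
Proof. by move=> c [a [b [? _]]]; exists a, b. Qed.

Lemma eq_class_relation (S S' : set D) :
  class_relation E S -> class_relation E S' ->
  (forall a b, rel_of E S a b <-> rel_of E S' a b) -> S = S'.
Proof.
move=> rS rS' SS'; apply/seteqP; split=> c Sc.
  have [a [b hc]] := rS _ Sc.
  have /SS'[c' hc' S'c'] : rel_of E S a b by exists c.
  by rewrite (opair_fun hc hc').
have [a [b hc]] := rS' _ Sc.
have /SS'[c' hc' S'c'] : rel_of E S' a b by exists c.
by rewrite (opair_fun hc hc').
Qed.

Definition isset (P : set D) : Prop := exists a, forall x, E x a <-> P x.

(** Separation for classes is Class Replacement along the identity restricted to [C]. *)
Lemma isset_sub (P C : set D) : X C -> isset P -> C `<=` P -> isset C.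
Proof.
have [_ _ cr _] := gb.
move=> XC [a aP] CP.
have XF : X (mkrel (fun x y => x = y /\ C x)).
  by apply: comprehension; rewrite /mkrel /=; definability.
have [|b bE] := cr _ XF _ a.
  by move=> x y y' /rel_mkrel[<- _] /rel_mkrel[<- _].
exists b => y; rewrite bE; split=> [[x _ /rel_mkrel[<-]]|Cy] //.
by exists y; [apply/aP/CP | apply/rel_mkrel].
Qed.

(** Replacement collects the sets coding the [Q r], which are unique by Extensionality, and Union
    flattens the result. *)
Lemma isset_bigcup (a : D) (Q : D -> D -> Prop) :
  X (mkrel Q) -> (forall r, E r a -> isset (Q r)) ->
  isset [set x | exists2 r, E r a & Q r x].
Proof.
have [[[ext _ _ union] _] _ cr _] := gb.
move=> XQ aQ.
have XF : X (mkrel (fun r s => forall x, E x s <-> rel_of E (mkrel Q) r x)).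
  by apply: comprehension; rewrite {1}/mkrel /=; definability.
have [|b bE] := cr _ XF _ a.
  move=> x y y' /rel_mkrel hy /rel_mkrel hy'.
  by apply: ext => z; rewrite hy hy'.
have [u uE] := union b; exists u => x; rewrite uE /=; split.
  move=> [s /bE[r ra /rel_mkrel hs]] /hs /rel_mkrel Qrx.
  by exists r.
move=> [r ra Qrx]; have [s sE] := aQ _ ra.
exists s; last exact/sE.
by apply/bE; exists r => //; apply/rel_mkrel => y; rewrite sE rel_mkrel.
Qed.

Lemma isset_pow (P : set D) : isset P -> isset [set x | forall z, E z x -> P z].
Proof.
have [[_ [power _ _ _]] _ _ _] := gb.
move=> [a aP]; have [p pE] := power a; exists p => x; rewrite pE /=.
by split=> h z /h /aP.
Qed.

Lemma isset1 a : isset [set a].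
Proof.
have [[[_ _ pairing _] _] _ _ _] := gb.
by have [c hc] := pairing a a; exists c => x; rewrite hc /=; split=> [[]|]; [| |left].
Qed.

Lemma issetU (P Q : set D) : isset P -> isset Q -> isset (P `|` Q).
Proof.
have [[[_ _ pairing union] _] _ _ _] := gb.
move=> [a aP] [b bQ]; have [c hc] := pairing a b; have [u uE] := union c.
exists u => x; rewrite uE; split.
  by move=> [y /hc[]->] => [/aP|/bQ]; [left|right].
by move=> [/aP|/bQ] xy; [exists a|exists b] => //; apply/hc; [left|right].
Qed.

Lemma isset0 : isset set0.
Proof.
have [[_ [_ [w [[x xw x0] _]] _ _]] _ _ _] := gb.
by exists x => z; split=> // /x0.
Qed.

(** For a set of Kuratowski pairs, this double union contains the entries of the pairs. *)
Lemma isset_bigcup2 (P : set D) : isset P ->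
  isset [set x | exists y z, [/\ P z, E y z & E x y]].
Proof.
have [[[_ _ _ union] _] _ _ _] := gb.
move=> [a aP]; have [u uE] := union a; have [v vE] := union u.
exists v => x; rewrite vE; split.
  by move=> [y /uE[z /aP Pz yz] xy]; exists y, z.
by move=> [y [z [/aP za yz xy]]]; exists y => //; apply/uE; exists z.
Qed.

Lemma X_mem (a : D) : X (E^~ a).
Proof. by apply: comprehension; definability. Qed.

(** * The transitive closure of a class relation *)

(* A first-order definition of the transitive closure: [t] is a set of
   instances of [R] witnessing [a < b]. *)
Definition TC (R : set D) (a b : D) : Prop :=
  exists t, (forall c, E c t -> R c) /\
    forall s, (forall x, (exists2 c, is_opair E x b c & E c t) -> E x s) ->
      (forall x y, E y s -> (exists2 c, is_opair E x y c & E c t) -> E x s) ->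
      E a s.

Lemma X_TC (R : set D) : X R -> X (mkrel (TC R)).
Proof. by move=> XR; apply: comprehension; rewrite /mkrel /TC /=; definability. Qed.

Lemma X_TC_l (R : set D) b : X R -> X (TC R ^~ b).
Proof. by move=> XR; apply: comprehension; rewrite /TC /=; definability. Qed.

(** The definition of [TC] quantifies over sets only, so [Q] is first cut down to a set: its
    intersection with the double union of the witness [t]. *)
Lemma TC_ind (R Q : set D) a b : X Q -> TC R a b ->
  (forall x, rel_of E R x b -> Q x) ->
  (forall x y, rel_of E R x y -> Q y -> Q x) -> Q a.
Proof.
move=> XQ [t [tR ht]] Qb Qstep.
have tset : isset (E^~ t) by exists t.
have XP : X [set x | Q x /\ exists y z, [/\ E z t, E y z & E x y]].
  apply: comprehension; apply: (@def_iff _ _ _ _ _ _ _ _ _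
    (fun _ e => Q (e tt) /\ exists y z, E z t /\ (E y z /\ E (e tt) y))).
    move=> _ e /=; split=> -[q [y [z]]]; first by move=> [? ? ?]; split=> //; exists y, z.
    by move=> [? [? ?]]; split=> //; exists y, z.
  by definability.
have [s sE] := isset_sub XP (isset_bigcup2 tset) (fun x => @proj2 _ _).
have fld x y c : is_opair E x y c -> E c t ->
    exists u v, [/\ E v t, E u v & E x u].
  move=> [s' [d [hs hd hc]]] ct.
  by exists s', c; split=> //; [apply/hc | apply/hs]; left.
have /sE[] // : E a s.
apply: ht => [x|x y /sE[Qy _]] [c hc ct]; apply/sE; split; try exact: fld hc ct.
  by apply: Qb; exists c => //; apply: tR.
by apply: Qstep Qy; exists c => //; apply: tR.
Qed.

Lemma TC1 (R : set D) a b : rel_of E R a b -> TC R a b.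
Proof.
move=> [c hc Rc]; have [t tE] := isset1 c; exists t; split=> [c' /tE -> //|s hs _].
by apply: hs; exists c => //; apply/tE.
Qed.

Lemma TC_step (R : set D) a b c : rel_of E R a b -> TC R b c -> TC R a c.
Proof.
move=> [d hd Rd] [t [tR ht]].
have [t' t'E] := issetU (ex_intro _ t (fun x => iff_refl (E x t))) (isset1 d).
exists t'; split=> [c' /t'E[/tR|->] //|s hs hs'].
apply: (hs' _ b); last by exists d => //; apply/t'E; right.
apply: ht => [x|x y ys] [c' hc' c't]; [apply: hs | apply: hs' ys _];
  by exists c' => //; apply/t'E; left.
Qed.

Lemma TC_trans (R : set D) a b c : X R -> TC R a b -> TC R b c -> TC R a c.
Proof.
move=> XR ab bc; apply: (TC_ind (X_TC_l c XR) ab) => [x xb|x y].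
  exact: TC_step bc.
exact: TC_step.
Qed.

(** [TC_ind] and [TC_step] work at the lower end of a chain; this gives access to the upper end. *)
Lemma TC_last (R : set D) a b : X R -> TC R a b ->
  rel_of E R a b \/ exists2 c, TC R a c & rel_of E R c b.
Proof.
move=> XR ab; have XT := X_TC XR.
have XQ : X [set x | rel_of E R x b \/
    exists2 c, rel_of E (mkrel (TC R)) x c & rel_of E R c b].
  by apply: comprehension; rewrite /=; definability.
have [||?|[c /rel_mkrel ? ?]] := TC_ind XQ ab; [by left| |by left|by right; exists c].
move=> x y xy [yb|[c /rel_mkrel yc cb]]; right.
  by exists y => //; apply/rel_mkrel/TC1.
by exists c => //; apply/rel_mkrel; apply: TC_step yc.
Qed.

(** [TC R] is a transitive class containing [R], and [TC_ind] puts it inside every other one. As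
    [TC] does not mention [X], models that share [R] compute the same closure. *)
Lemma trans_closureE (R : set D) : X R -> class_relation E R ->
  trans_closure E X R = TC R.
Proof.
move=> XR rR; apply: funext => a; apply: funext => b; apply/propext; split.
  move=> /(_ _ (X_TC XR) (@mkrel_relation _)) h; apply/rel_mkrel/h.
    by move=> x y z /rel_mkrel xy /rel_mkrel yz; apply/rel_mkrel; apply: TC_trans yz.
  move=> c Rc; have [x [y hc]] := rR _ Rc; exists x, y; split=> //.
  by apply: TC1; exists c.
move=> ab T XT rT Ttrans RT.
have XQ : X (fun x => rel_of E T x b) by apply: comprehension; definability.
have RTrel x y : rel_of E R x y -> rel_of E T x y.
  by move=> [c hc /RT]; exists c.
apply: (TC_ind XQ ab) => [x /RTrel //|x y /RTrel]; exact: Ttrans.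
Qed.

(** In general [TC] may allow chains of nonstandard length; if [R] is truly well-founded, then
    peeling off last steps terminates. *)
Lemma TC_clos_trans (R : set D) : X R -> well_founded (rel_of E R) ->
  TC R = clos_trans D (rel_of E R).
Proof.
move=> XR wfR; apply: funext => a; apply: funext => b; apply/propext; split.
  elim/(well_founded_ind wfR): b => b IH /(TC_last XR)[ab|[c ac cb]].
    exact: t_step.
  by apply: t_trans (IH _ cb ac) (t_step _ _ _ _ cb).
by elim=> [x y|x y z _ xy _ yz]; [apply: TC1 | apply: TC_trans yz].
Qed.

End GodelBernays.

(** * True well-foundedness *)

Lemma wellfounded_Acc (D : Type) (E : D -> D -> Prop) (R : set D) :
  wellfounded E setT R -> well_founded (rel_of E R).
Proof.
move=> [_ wfR] x; apply: contrapT => nx.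
have [|a na amin] := wfR [set x | ~ Acc (rel_of E R) x] I; first by exists x.
by apply: na; constructor=> y /amin nny; apply: contrapT => ny; apply: nny.
Qed.

Lemma well_founded_min {T : Type} {R : T -> T -> Prop} (C : set T) :
  well_founded R -> C !=set0 -> exists2 a, C a & forall b, C b -> ~ R b a.
Proof.
move=> wfR [x]; elim/(well_founded_ind wfR): x => x IH Cx.
have [[y [Cy yx]]|nex] := EM (exists y, C y /\ R y x); first exact: IH yx Cy.
by exists x => // b Cb bx; apply: nex; exists b.
Qed.

Lemma well_founded_irr {T : Type} {R : T -> T -> Prop} {x : T} :
  well_founded R -> ~ R x x.
Proof. by move=> wfR; elim/(well_founded_ind wfR): x => x IH xx; exact: (IH _ xx xx). Qed.

(** * Recursion along class relations and along membership *)

Section ElementaryTransfiniteRecursion.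
Variables (D : Type) (E : D -> D -> Prop) (X : set (set D)).
Hypotheses (gb : GB E X) (etr : ETR E X) (wfE : well_founded E).

Lemma rel_restr (R S : set D) r r' x : X R -> class_relation E R ->
  rel_of E (restr E X R S r) r' x <-> rel_of E S r' x /\ TC E R r' r.
Proof.
move=> XR rR; rewrite /restr (trans_closureE gb XR rR); split.
  move=> [c hc [Sc [a [b [hc' ar]]]]]; split; first by exists c.
  by have [-> _] := opair_inj hc hc'.
by move=> [[c hc Sc] r'r]; exists c => //; split=> //; exists r', x.
Qed.

(** [ETR] restated for definable predicates, with the restriction [Y] known only through its pairs.
    The formulas of [ETR] have no set parameters, whence [of_void]: all data must be coded in the
    single class [A]. *)
Lemma transfinite_recursion (P : set D -> D -> Prop) (A R : set D) :
  definable E (etr_env A) (of_void D)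
    (fun Y (e : unit -> D) => P Y (e tt)) ->
  X A -> X R -> wellfounded E X R ->
  exists2 S, X S & class_relation E S /\
    forall r, dom E R r -> exists2 Y,
      forall r' x, rel_of E Y r' x <-> rel_of E S r' x /\ TC E R r' r &
      forall x, rel_of E S r x <-> P Y x.
Proof.
move=> [phi phiE] XA XR wfR; have [rR _] := wfR.
pose h (v : unit + void) := match v with inl w => w | inr c => of_void unit c end.
have [S XS [domS SE]] := etr (frename id h phi) XA XR wfR.
exists S => //; split=> [c /domS[r [x [? _]]]|r rdom]; first by exists r, x.
exists (restr E X R S r) => [r' x|x]; first exact: rel_restr.
have -> : rel_of E S r x <-> slice E S r x by [].
rewrite (SE r rdom) /= (phiE _ (fun=> x)).
have sE : venv (of_void D) (fun=> x) = (fun _ : unit => x) \o h.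
  by apply: funext => -[[]|[]].
by rewrite sE; apply: sat_frename.
Qed.

Definition below : D -> D -> Prop := clos_trans D E.

Lemma wf_below : well_founded below.
Proof. exact: wf_clos_trans. Qed.

Lemma rel_of_mem : rel_of E (mkrel E E) = E.
Proof.
by apply: funext => a; apply: funext => b; apply/propext/(rel_mkrel gb).
Qed.

Lemma X_memrel : X (mkrel E E).
Proof. by apply: (comprehension gb); rewrite /mkrel /=; definability. Qed.

Lemma TC_mem : TC E (mkrel E E) = below.
Proof. by rewrite (TC_clos_trans gb X_memrel) rel_of_mem. Qed.

Lemma X_below : X (mkrel E below).
Proof. by rewrite -TC_mem; apply: X_TC => //; apply: X_memrel. Qed.

Lemma mem_recursion (P : set D -> D -> Prop) (A : set D) :
  definable E (etr_env A) (of_void D)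
    (fun Y (e : unit -> D) => P Y (e tt)) ->
  X A ->
  exists2 S, X S & forall r, exists2 Y,
      forall r' x, rel_of E Y r' x <-> rel_of E S r' x /\ below r' r &
      forall x, rel_of E S r x <-> P Y x.
Proof.
move=> defP XA.
have wfR : wellfounded E X (mkrel E E).
  split=> [|C _ C0]; first exact: mkrel_relation.
  by rewrite rel_of_mem; apply: well_founded_min.
have [S XS [_ SE]] := transfinite_recursion P defP XA X_memrel wfR.
exists S => // r; rewrite -TC_mem; apply: SE.
(* Every [r] is in the domain of membership because it belongs to its singleton. *)
have [s sE] := isset1 gb r; exists s; left; rewrite rel_of_mem; exact/sE.
Qed.

(** By membership induction: what is below [r] is the union, over [y] in [r], of the singleton of
    [y] and what is below [y]. *)
Lemma isset_below r : isset E (below^~ r).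
Proof.
elim/(well_founded_ind wfE): r => r IH.
have XQ : X (mkrel E (fun y x => x = y \/ rel_of E (mkrel E below) x y)).
  have Xb := X_below.
  by apply: (comprehension gb); rewrite {1}/mkrel /=; definability.
have [y yr|a aE] := isset_bigcup gb r _ XQ.
  have [a aE] := issetU gb (isset1 gb y) (IH _ yr).
  exists a => x; rewrite aE (rel_mkrel gb); split=> -[]; by [left|right].
exists a => x; rewrite aE /=; split.
  move=> [y yr [->|/(rel_mkrel gb) xy]]; first exact: t_step.
  exact: t_trans xy (t_step _ _ _ _ yr).
move=> xr; have {xr} : clos_trans_n1 D E x r by apply: clos_trans_tn1.
case=> [|y z yz xy]; first by exists x => //; left.
exists y => //; right; apply/(rel_mkrel gb); exact: clos_tn1_trans.
Qed.

(** * Comparison of ranks *)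

(* [rel_of E U r x] means that the rank of [x] is at most that of [r]. *)
Definition rank_class (U : set D) : Prop :=
  X U /\ forall r x, rel_of E U r x <->
    forall y, E y x -> exists2 r', below r' r & rel_of E U r' y.

Lemma rank_class_ex : exists U, rank_class U.
Proof.
have [|U XU UE] := @mem_recursion
  (fun Y x => forall y, E y x -> exists r', rel_of E Y r' y) (mkrel E E) _ X_memrel.
  by definability.
exists U; split=> // r x; have [Y YE ->] := UE r; split=> h y yx.
  by have [r' /YE[r'y r'r]] := h _ yx; exists r'.
by have [r' r'r r'y] := h _ yx; exists r'; apply/YE.
Qed.

Section Rank.
Variable U : set D.
Hypothesis rankU : rank_class U.

Let le (x y : D) : Prop := rel_of E U y x.

Lemma le_below x x' y : below x' x -> le x y -> exists2 y', below y' y & le x' y'.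
Proof.
have [_ UE] := rankU.
move=> x'x; elim: x'x y => {x' x} [x' x x'x y /UE|x1 x2 x3 _ IH1 _ IH2 y /IH2].
  by move=> /(_ _ x'x).
move=> [y2 y2y /IH1[y1 y1y2 x1y1]]; exists y1 => //; exact: t_trans y1y2 y2y.
Qed.

Lemma le_refl x : le x x.
Proof.
have [_ UE] := rankU.
elim/(well_founded_ind wfE): x => x IH; apply/UE => y yx.
by exists y; [apply: t_step | apply: IH].
Qed.

Lemma le_trans x y z : le x y -> le y z -> le x z.
Proof.
have [_ UE] := rankU.
elim/(well_founded_ind wfE): x y z => x IH y z /UE xy yz; apply/UE => x' x'x.
have [y' y'y x'y'] := xy _ x'x; have [z' z'z y'z'] := le_below y'y yz.
by exists z' => //; apply: IH y'z'.
Qed.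

Lemma le_mem x y : E x y -> le x y.
Proof.
have [_ UE] := rankU.
move=> xy; apply/UE => z zx; exists z; last exact: le_refl.
by apply: t_trans (t_step _ _ _ _ xy); apply: t_step.
Qed.

(** Failure of [le y x] gives a [y'] in [y] whose rank is not bounded by anything below [x];
    membership induction on [x] shows that any such [y'] satisfies [le x y']. *)
Lemma nle_mem x y : ~ le y x -> exists2 y', E y' y & le x y'.
Proof.
have [_ UE] := rankU.
have not_below u v : ~ le u v ->
    exists2 u', E u' u & forall v', below v' v -> ~ le u' v'.
  move=> nuv; apply: contrapT => nex; apply: nuv; apply/UE => u' u'u.
  apply: contrapT => nv; apply: nex; exists u' => // v' v'v u'v'.
  by apply: nv; exists v'.
move=> /not_below[y' y'y ny']; exists y' => //.
elim/(well_founded_ind wfE): x y' {y y'y} ny' => x IH y ny; apply/UE => x' x'x.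
have /not_below[y' y'y ny'] := ny _ (t_step _ _ _ _ x'x).
by exists y'; [apply: t_step | apply: IH].
Qed.

Lemma le_total x y : le x y \/ le y x.
Proof.
have [|/nle_mem[x' x'x yx']] := EM (le x y); [by left | right].
exact: le_trans yx' (le_mem x'x).
Qed.

(** This relation is strict inequality of ranks. Induction along [below] on a bound [y] makes
    everything of rank at most that of [y] accessible. *)
Lemma wf_nle : well_founded (fun x y => ~ le y x).
Proof.
suff acc y : forall x, le x y -> Acc (fun x y => ~ le y x) x.
  by move=> x; apply: acc (le_refl x).
elim/(well_founded_ind wf_below): y => y IH x xy; constructor=> z.
move=> /nle_mem[x' x'x zx'].
have [y' y'y x'y'] := le_below (t_step _ _ _ _ x'x) xy.
exact: IH y'y _ (le_trans zx' x'y').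
Qed.

(** These are the levels of the cumulative hierarchy: each is the power set of the union of the
    levels of the sets below [y]. *)
Lemma isset_le y : isset E (le^~ y).
Proof.
have [XU UE] := rankU.
elim/(well_founded_ind wf_below): y => y IH.
have [b bE] := isset_below y.
have XQ : X (mkrel E (fun r x => rel_of E U r x)).
  by apply: (comprehension gb); rewrite /mkrel /=; definability.
have [r /bE|a aE] := isset_pow gb (isset_bigcup gb b _ XQ _); first exact: IH.
exists a => x; rewrite aE /= /le UE.
by split=> h z /h [r /bE ? ?]; exists r => //; apply/bE.
Qed.

(** Scott's trick: a class is replaced by a set that is nonempty whenever the class is. *)
Definition least_rank (C : set D) : set D :=
  [set x | C x /\ forall u, C u -> le x u].

Lemma least_rank_nonempty (C : set D) : C !=set0 -> least_rank C !=set0.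
Proof.
move=> C0; have [x Cx xmin] := well_founded_min wf_nle C0.
by exists x; split=> // u /xmin; apply: contrapT.
Qed.

Lemma isset_least_rank (C : set D) : X C -> isset E (least_rank C).
Proof.
have [XU _] := rankU; move=> XC.
have Xm : X (least_rank C).
  by apply: (comprehension gb); rewrite /least_rank /le /=; definability.
have [[u Cu]|C0] := EM (C !=set0).
  by apply: (isset_sub gb Xm (isset_le u)) => x [_]; apply.
by apply: (isset_sub gb Xm (isset0 gb)) => x [Cx _]; apply: C0; exists x.
Qed.

(** * Well-foundedness tested on sets *)

(* A class without [R]-minimal elements has a nonempty subset without
   [R]-minimal elements: close a point under least-rank predecessors. *)
Lemma wellfounded_by_sets (R : set D) : X R -> class_relation E R ->
  (forall c, (exists x, E x c) ->
     exists2 a, E a c & forall b, E b c -> ~ rel_of E R b a) ->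
  wellfounded E X R.
Proof.
have [XU _] := rankU; move=> XR rR Rmin; split=> // C XC [x0 Cx0].
apply: contrapT => nex.
have pred z : C z -> exists x, C x /\ rel_of E R x z.
  move=> Cz; apply: contrapT => nz; apply: nex; exists z => // b Cb bz.
  by apply: nz; exists b.
(* Taking all predecessors of least rank requires no choice and keeps every stage of the closure a
   set. *)
pose N z := least_rank [set x | C x /\ rel_of E R x z].
have setN z : isset E (N z).
  by apply: isset_least_rank; apply: (comprehension gb); rewrite /=; definability.
have Nloop x : ~ N x x.
  move=> [[_ xx] _]; have [c cE] := isset1 gb x.
  have [|a /cE -> nx] := Rmin c; first by exists x; apply/cE.
  by apply: (nx x) => //; apply/cE.
(* One class parameter has to code both [N] and the starting point. By [Nloop], [N] is irreflexive,
   so [x0] can be recovered as the only point on the diagonal of [A]. *)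
pose A := mkrel E (fun x z => N z x \/ (x = x0 /\ z = x0)).
have XA : X A.
  by apply: (comprehension gb); rewrite /A /mkrel /N /least_rank /le /=; definability.
have [|S XS SE] := @mem_recursion
  (fun Y x => exists z, rel_of E A x z /\ (z = x \/ exists r', rel_of E Y r' z))
  A _ XA; first by definability.
(* Stage [r] consists of [x0] and the [N]-successors of points of the stages below [r]. *)
have {}SE r x : rel_of E S r x <->
    x = x0 \/ exists2 r', below r' r & exists2 z, rel_of E S r' z & N z x.
  have [Y YE ->] := SE r; split.
    move=> [z [/(rel_mkrel gb)[Nzx|[-> _]]]]; last by left.
    move=> [zx|[r' /YE[r'z r'r]]]; first by rewrite zx in Nzx; have := Nloop _ Nzx.
    by right; exists r' => //; exists z.
  move=> [->|[r' r'r [z r'z Nzx]]].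
    by exists x0; split; [apply/(rel_mkrel gb); right | left].
  exists z; split; first by apply/(rel_mkrel gb); left.
  by right; exists r'; apply/YE.
have SC r x : rel_of E S r x -> C x by move=> /SE[->//|[_ _ [z _ [[]]]]].
have setS r : isset E (rel_of E S r).
  elim/(well_founded_ind wf_below): r => r IH.
  have XQ' : X (mkrel E N).
    by apply: (comprehension gb); rewrite /mkrel /N /least_rank /le /=; definability.
  have XQ : X (mkrel E (fun r' x =>
      exists2 z, rel_of E S r' z & rel_of E (mkrel E N) z x)).
    by apply: (comprehension gb); rewrite {1}/mkrel /=; definability.
  have [b bE] := isset_below r.
  have [r' /bE r'r|d dE] := isset_bigcup gb b _ XQ.
    have [s sE] := IH _ r'r.
    have [d dE] := isset_bigcup gb s _ XQ' (fun z _ => setN z).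
    exists d => x; rewrite dE; split=> -[z].
      by move=> /sE r'z Nzx; exists z => //; apply/(rel_mkrel gb).
    by move=> /sE r'z /(rel_mkrel gb) Nzx; exists z.
  have [f fE] := issetU gb (isset1 gb x0) (ex_intro _ d dE).
  exists f => x; rewrite fE SE; split.
    move=> [->|[r' /bE r'r [z r'z /(rel_mkrel gb) Nzx]]]; [by left|right].
    by exists r' => //; exists z.
  move=> [->|[r' /bE r'r [z r'z Nzx]]]; [by left|right; exists r' => //].
  by exists z => //; apply/(rel_mkrel gb).
have [[_ [_ [w [[o ow _] wS]] _ _]] _ _ _] := gb.
have XQ : X (mkrel E (rel_of E S)).
  by apply: (comprehension gb); rewrite /mkrel /=; definability.
(* The stages indexed by an inductive set [w] suffice: a minimal [a] from stage [r] has a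
   predecessor in [N a], which enters at the successor of [r]. *)
have [c cE] := isset_bigcup gb w _ XQ (fun r _ => setS r).
have [|a /cE[r rw rS] amin] := Rmin c.
  by exists x0; apply/cE; exists o => //; apply/SE; left.
have [b Nab] : N a !=set0.
  by apply: least_rank_nonempty; have [x ?] := pred _ (SC _ _ rS); exists x.
have [r' r'w r'E] := wS _ rw.
apply: (amin b); last by case: Nab => -[].
apply/cE; exists r' => //; apply/SE; right; exists r; last by exists a.
by apply: t_step; apply/r'E; right.
Qed.

End Rank.

(** The right-hand side does not depend on [X], which makes well-foundedness comparable between
    realizations. *)
Lemma wellfoundedP (R : set D) : X R ->
  wellfounded E X R <-> class_relation E R /\ forall c, (exists x, E x c) ->
     exists2 a, E a c & forall b, E b c -> ~ rel_of E R b a.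
Proof.
move=> XR; split=> [[rR wfR]|[rR Rmin]].
  by split=> // c c0; exact: (wfR _ (X_mem gb c) c0).
by have [U rankU] := rank_class_ex; exact: (wellfounded_by_sets rankU).
Qed.

(** * Global Choice from a definable global well-order *)

Lemma X_definable_rel n (phi : formula void (option (option 'I_n))) (p : 'I_n -> D) :
  X (mkrel E (fun x y => sat E phi (@no_class D) (scons y (scons x p)))).
Proof.
apply: (comprehension gb); rewrite /mkrel /=; definability.
pose h (v : option (option 'I_n)) : option (option unit) + D :=
  match v with None => inl None | Some None => inl (Some None)
             | Some (Some i) => inr (p i) end.
exists (frename (of_void {A | X A}) h phi) => i e; apply: iff_sym.
have := sat_frename E (of_void {A | X A}) h phi sval (venv id e).
have -> : venv id e \o h = scons (e None) (scons (e (Some None)) p).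
  by apply: funext => -[[]|].
by have -> : sval \o of_void {A | X A} = @no_class D by apply: funext => -[].
Qed.

Section GlobalChoice.
Hypothesis beta : forall R, X R -> wellfounded E X R -> wellfounded E setT R.
Variable lt : D -> D -> Prop.
Hypotheses (Xlt : X (mkrel E lt)) (lt_irr : forall x, ~ lt x x)
  (lt_trans : forall x y z, lt x y -> lt y z -> lt x z)
  (lt_total : forall x y, [\/ lt x y, x = y | lt y x])
  (lt_min : forall a, (exists x, E x a) ->
     exists2 x, E x a & forall y, E y a -> x = y \/ lt x y).
Variable U : set D.
Hypothesis rankU : rank_class U.

(* Ordering by rank first makes the proper initial segments sets. *)
Let prec (x y : D) : Prop := rel_of E U y x /\ (rel_of E U x y -> lt x y).

Lemma prec_irr x : ~ prec x x.
Proof. by move=> [xx /(_ xx)/lt_irr]. Qed.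

Lemma prec_trans x y z : prec x y -> prec y z -> prec x z.
Proof.
move=> [xy ltxy] [yz ltyz]; split=> [|zx]; first exact: le_trans rankU _ _ _ xy yz.
apply: (lt_trans (ltxy _) (ltyz _)); first exact: le_trans rankU _ _ _ yz zx.
exact: le_trans rankU _ _ _ zx xy.
Qed.

Lemma prec_total x y : [\/ prec x y, x = y | prec y x].
Proof.
have := le_total rankU x y.
have [xy|nxy] := EM (rel_of E U y x);
  have [yx|nyx] := EM (rel_of E U x y); last by case.
- by case: (lt_total x y) => ? _; [apply: Or31; split|apply: Or32|apply: Or33; split].
- by move=> _; apply: Or31; split.
- by move=> _; apply: Or33; split.
Qed.

Lemma X_prec : X (mkrel E prec).
Proof.
have [XU _] := rankU.
suff -> : prec = fun x y =>
    rel_of E U y x /\ (rel_of E U x y -> rel_of E (mkrel E lt) x y).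
  by apply: (comprehension gb); rewrite {1}/mkrel /=; definability.
apply: funext => x; apply: funext => y; apply/propext.
by split=> -[xy h]; split=> // /h /(rel_mkrel gb).
Qed.

Lemma rel_of_prec : rel_of E (mkrel E prec) = prec.
Proof.
by apply: funext => a; apply: funext => b; apply/propext/(rel_mkrel gb).
Qed.

(** Least elements for [lt] are given only in sets, so the minimum is taken among the members of [C]
    of least rank. *)
Lemma prec_wellfounded : wellfounded E X (mkrel E prec).
Proof.
split=> [|C XC C0]; first exact: mkrel_relation.
have [a aE] := isset_least_rank rankU XC.
have [x Cx] := least_rank_nonempty rankU C0.
have [|m /aE[Cm mmin] ltm] := @lt_min a; first by exists x; apply/aE.
exists m => // b Cb; rewrite rel_of_prec => -[bm ltbm].
have /ltm[mb|ltmb] : E b a.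
- by apply/aE; split=> // u /mmin; apply: le_trans rankU _ _ _ bm.
- by apply: (@prec_irr b); rewrite mb in bm ltbm; split.
- exact: (lt_irr (lt_trans (ltbm (mmin _ Cb)) ltmb)).
Qed.

Lemma wf_prec : well_founded prec.
Proof.
rewrite -rel_of_prec; apply: wellfounded_Acc; exact: beta X_prec prec_wellfounded.
Qed.

Lemma TC_prec : TC E (mkrel E prec) = prec.
Proof.
rewrite (TC_clos_trans gb X_prec) rel_of_prec; last exact: wf_prec.
apply: funext => a; apply: funext => b; apply/propext; split; last exact: t_step.
by elim=> // x y z _ xy _ yz; apply: prec_trans yz.
Qed.

(* [F] is the graph of the Mostowski collapse of [prec]. *)
Lemma collapse_ex : exists2 F, X F & class_relation E F /\
  forall x o, rel_of E F x o <->
    forall z, E z o <-> exists2 y, prec y x & rel_of E F y z.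
Proof.
have [|F XF [rF FE]] := @transfinite_recursion
  (fun Y o => forall z, E z o <-> exists y, rel_of E Y y z) (mkrel E prec) _ _
  X_prec X_prec prec_wellfounded; first by definability.
exists F => //; split=> // x o.
have [|Y YE ->] := FE x.
  (* The element [x] is in the domain of [prec], being comparable with its singleton and different
     from it. *)
  have [s sE] := isset1 gb x; exists s; rewrite rel_of_prec.
  have xs : E x s by apply/sE.
  case: (prec_total x s) => [?|xs'|?]; [by left| |by right].
  by rewrite -xs' in xs; case: (well_founded_irr wfE xs).
rewrite TC_prec in YE.
split=> h z; rewrite h; split.
- by move=> [y /YE[]]; exists y.
- by move=> [y yx yz]; exists y; apply/YE.
- by move=> [y yx yz]; exists y; apply/YE.
- by move=> [y /YE[]]; exists y.
Qed.

(** The bijection is the collapse [F] of [prec]. It is order preserving, so it is injective and its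
    values are transitive and linearly ordered by membership. *)
Lemma definable_global_choice : GlobalChoice E X.
Proof.
have [[[ext _ _ _] _] _ _ _] := gb.
have [F XF [rF FE]] := collapse_ex.
have XP := X_prec; have [XU _] := rankU.
have F_fun x o o' : rel_of E F x o -> rel_of E F x o' -> o = o'.
  by move=> /FE h /FE h'; apply: ext => z; rewrite h h'.
have F_tot x : exists o, rel_of E F x o.
  elim/(well_founded_ind wf_prec): x => x IH.
  have Xpred : X (prec^~ x).
    suff -> : prec^~ x = fun y => rel_of E (mkrel E prec) y x.
      by apply: (comprehension gb); definability.
    by rewrite rel_of_prec.
  (* The predecessors of [x] have at most its rank and hence form a set, to which Replacement
     applies. *)
  have [p pE] := isset_sub gb Xpred (isset_le rankU x) (fun y => @proj1 _ _).
  have XQ : X (mkrel E (rel_of E F)).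
    by apply: (comprehension gb); rewrite /mkrel /=; definability.
  have [y /pE yx|o oE] := isset_bigcup gb p _ XQ.
    have [o yo] := IH _ yx; have [s sE] := isset1 gb o; exists s => z; rewrite sE.
    by split=> [->//|yz]; apply: F_fun yz yo.
  exists o; apply/FE => z; rewrite oE /=.
  by split=> -[y /pE ? ?]; exists y => //; apply/pE.
have F_mono x y o o' : rel_of E F x o -> rel_of E F y o' -> prec x y -> E o o'.
  by move=> xo /FE h xy; apply/h; exists x.
have F_inj x y o : rel_of E F x o -> rel_of E F y o -> x = y.
  move=> xo yo; case: (prec_total x y) => // [xy|yx].
    by case: (well_founded_irr wfE (F_mono _ _ _ _ xo yo xy)).
  by case: (well_founded_irr wfE (F_mono _ _ _ _ yo xo yx)).
have F_memE x o z : rel_of E F x o -> E z o -> exists2 y, prec y x & rel_of E F y z.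
  by move=> /FE h /h.
exists F => //; split=> //.
- move=> x o xo; split=> [u v vo uv|u v uo vo].
    have [y yx yv] := F_memE _ _ _ xo vo; have [z zy zu] := F_memE _ _ _ yv uv.
    exact: F_mono zu xo (prec_trans zy yx).
  have [y yx yu] := F_memE _ _ _ xo uo; have [z zx zv] := F_memE _ _ _ xo vo.
  case: (prec_total y z) => [yz|yz|zy].
  + by apply: Or31; apply: F_mono yu zv yz.
  + by apply: Or32; apply: F_fun yu _; rewrite yz.
  + by apply: Or33; apply: F_mono zv yu zy.
- by move=> x; have [o xo] := F_tot x; exists o; split=> // o' xo'; apply: F_fun xo xo'.
move=> a ord_a.
suff [x xa] : exists x, rel_of E F x a.
  by exists x; split=> // y ya; apply: F_inj xa ya.
elim/(well_founded_ind wfE): a ord_a => a IH [atr acmp].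
(* Elements of an ordinal are ordinals, so the induction hypothesis covers them; the cases other
   than transitivity are membership cycles. *)
have inrange b : E b a -> exists x, rel_of E F x b.
  move=> ba; apply: IH => //; split=> [x y yb xy|x y xb yb]; last first.
    by apply: acmp; apply: atr ba _.
  have ya := atr _ _ ba yb; have xa := atr _ _ ya xy.
  case: (acmp _ _ xa ba) => // [xb|bx].
    rewrite xb in xy; have : clos_trans D E b b.
      exact: t_trans (t_step _ _ _ _ xy) (t_step _ _ _ _ yb).
    by move=> bb; case: (well_founded_irr wf_below bb).
  have : clos_trans D E b b.
    apply: t_trans (t_step _ _ _ _ yb).
    exact: t_trans (t_step _ _ _ _ bx) (t_step _ _ _ _ xy).
  by move=> bb; case: (well_founded_irr wf_below bb).
have XQ : X (mkrel E (fun b x => rel_of E F x b)).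
  by apply: (comprehension gb); rewrite /mkrel /=; definability.
have [b ba|p pE] := isset_bigcup gb a _ XQ.
  have [x xb] := inrange _ ba; have [s sE] := isset1 gb x; exists s => z; rewrite sE.
  by split=> [->//|zb]; apply: F_inj zb xb.
(* Here [p] is the set of preimages of elements of [a]. Something lies outside it, namely [p]
   itself, and the [prec]-least such [x] collapses to [a]. *)
have [|x nx xmin] := well_founded_min wf_prec (C := fun x => ~ E x p).
  by exists p => pp; case: (well_founded_irr wfE pp).
have {}xmin y : prec y x -> E y p.
  by move=> yx; apply: contrapT => ny; apply: (xmin y).
exists x; apply/FE => z; split=> [za|[y /xmin/pE[b ba yb] yz]]; last first.
  by rewrite (F_fun _ _ _ yz yb).
have [y yz] := inrange _ za; exists y => //.
have yp : E y p by apply/pE; exists z.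
(* If [x] preceded [y], then its value would be in [z], hence in [a], and [x] would lie in [p]. *)
case: (prec_total y x) => // [yx|xy]; first by rewrite yx in yp.
case: nx; apply/pE; have [o xo] := F_tot x; exists o => //.
by apply: atr za _; apply: F_mono xo yz xy.
Qed.

End GlobalChoice.
End ElementaryTransfiniteRecursion.

(** * True membership, and uniqueness of recursive solutions *)

Lemma wf_vmem : well_founded vmem.
Proof.
suff acc t : Acc vmem (vset t) by move=> x; rewrite -(vset_repr x).
elim: t => A f IH; constructor=> y; rewrite -(vset_repr y) => /vmem_vset[a].
by move=> /vset_eqP ->.
Qed.

Lemma wf_Emem (M : V) : well_founded (Emem M).
Proof. exact: (wf_inverse_image _ _ vmem sval wf_vmem). Qed.

(** Both models restrict along [TC R], here the true transitive closure, so induction along it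
    identifies the slices. Outside [dom E R] both solutions have no pairs. *)
Lemma etr_solution_unique (D : Type) (E : D -> D -> Prop) (X X' : set (set D))
    (phi : formula bool unit) (A R S S' : set D) :
  GB E X -> GB E X' -> X R -> X' R -> wellfounded E setT R ->
  (forall c, S c -> exists r x, is_opair E r x c /\ dom E R r) ->
  (forall c, S' c -> exists r x, is_opair E r x c /\ dom E R r) ->
  (forall r, dom E R r -> slice E S r =
     [set x | sat E phi (fun Y => if Y then restr E X R S r else A) (fun=> x)]) ->
  (forall r, dom E R r -> slice E S' r =
     [set x | sat E phi (fun Y => if Y then restr E X' R S' r else A) (fun=> x)]) ->
  S = S'.
Proof.
move=> gb gb' XR X'R wfR domS domS' SE S'E; have [rR _] := wfR.
have wf := wf_clos_trans _ _ (wellfounded_Acc wfR).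
have tcE := trans_closureE gb XR rR; have tcE' := trans_closureE gb' X'R rR.
have slice_eq r : dom E R r -> slice E S r = slice E S' r.
  elim/(well_founded_ind wf): r => r IH rdom; rewrite (SE _ rdom) (S'E _ rdom).
  suff -> : restr E X R S r = restr E X' R S' r by [].
  rewrite /restr tcE tcE' (TC_clos_trans gb XR (wellfounded_Acc wfR)).
  have sub T T' : (forall c, T c -> exists r x, is_opair E r x c /\ dom E R r) ->
      (forall r', clos_trans _ (rel_of E R) r' r -> dom E R r' ->
         slice E T r' = slice E T' r') ->
      [set c | T c /\ exists r' x, is_opair E r' x c /\
        clos_trans _ (rel_of E R) r' r] `<=`
      [set c | T' c /\ exists r' x, is_opair E r' x c /\
        clos_trans _ (rel_of E R) r' r].
    move=> domT TT' c [Tc [r' [x [hc r'r]]]]; split; last by exists r', x.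
    have [r1 [x1 [hc1 r1dom]]] := domT _ Tc; have [r1E _] := opair_inj hc1 hc.
    subst r1.
    have : slice E T r' x by exists c.
    by rewrite TT' // => -[c' hc' T'c']; rewrite (opair_fun gb hc hc').
  apply/seteqP; split; first exact: (sub _ _ domS).
  by apply: (sub _ _ domS') => r' r'r r'dom; rewrite IH.
apply: (eq_class_relation gb) => [c /domS[r [x []]]|c /domS'[r [x []]]|r x].
- by exists r, x.
- by exists r, x.
have [rdom|nrdom] := EM (dom E R r).
  by have := slice_eq _ rdom => /(congr1 (@^~ x)) eq; rewrite /slice /= in eq; rewrite eq.
split=> -[c hc] => [/domS|/domS'] [r1 [x1 [hc1 r1dom]]];
  by have [r1E _] := opair_inj hc1 hc; rewrite r1E in r1dom.
Qed.

(** * The intersection of all realizations *)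

Unset Implicit Arguments.

Theorem theorem5p1 (M : V) (M_ZF : ZF (Emem M))
    (M_realizable : beta_realizable GB_ETR M) :
  exists X0 : set (set (elts M)),
    [/\ beta_realization GB_ETR X0,
        forall X : set (set (elts M)),
          beta_realization GB_ETR X -> X0 `<=` X &
        definable_global_wellorder (Emem M) -> GlobalChoice (Emem M) X0].
Proof.
have wfE := @wf_Emem M.
have [X1 real1] := M_realizable; have [[gb1 etr1] [trM beta1]] := real1.
pose X0 : set (set (elts M)) := [set A | forall X, beta_realization GB_ETR X -> X A].
have X0_sub X : beta_realization GB_ETR X -> X0 `<=` X by move=> rX A; apply.
(* ZF concerns sets alone, Class Extensionality and Class Replacement are universal over classes and
   descend from [X1], and each instance of comprehension lies in every realization. *)
have gb0 : GB (Emem M) X0.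
  have [_ cext1 cr1 _] := gb1; split=> //.
  - by move=> A B /(_ _ real1) XA /(_ _ real1) XB; apply: cext1.
  - by move=> F /(_ _ real1); apply: cr1.
  - move=> k n phi C p XC X rX; have [[[_ _ _ ec] _] _] := rX.
    by apply: ec => i; apply: XC.
have wf0 R : X0 R -> wellfounded (Emem M) X0 R ->
    forall X, beta_realization GB_ETR X -> wellfounded (Emem M) X R.
  move=> X0R [rR wfR] X rX; have [[gb etr] _] := rX.
  (* The criterion is used in [X], where ETR is known; on the side of [X0], it is enough that every
     set is a class. *)
  apply/(wellfoundedP gb etr wfE R (X0R _ rX)); split=> // c c0.
  exact: (wfR _ (X_mem gb0 c) c0).
have beta0 R : X0 R -> wellfounded (Emem M) X0 R -> wellfounded (Emem M) setT R.
  by move=> X0R /(wf0 _ X0R)/(_ _ real1); apply: beta1; apply: X0R.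
have etr0 : ETR (Emem M) X0.
  move=> phi A R X0A X0R wfR; have wfRT := beta0 _ X0R wfR; have [rR _] := wfR.
  have [S1 XS1 [domS1 S1E]] :=
    etr1 phi A R (X0A _ real1) (X0R _ real1) (wf0 _ X0R wfR _ real1).
  (* By uniqueness, the solution found in [X1] is the one found in any other realization, so it
     belongs to [X0]. *)
  exists S1.
    move=> X rX; have [[gb etr] _] := rX.
    have [S XS [domS SE]] :=
      etr phi A R (X0A _ rX) (X0R _ rX) (wf0 _ X0R wfR _ rX).
    by rewrite (@etr_solution_unique _ _ _ _ _ _ _ _ _ gb1 gb (X0R _ real1)
      (X0R _ rX) wfRT domS1 domS S1E SE).
  (* The recursion equation carries over from [X1] because the transitive closures computed in [X1]
     and [X0] agree. *)
  split=> // r rdom; rewrite (S1E _ rdom) /restr.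
  by rewrite (trans_closureE gb1 (X0R _ real1) rR) (trans_closureE gb0 X0R rR).
exists X0; split=> [|//|[n [phi [p [irr tr tot lmin]]]]].
  by split; split.
have [U rankU] := rank_class_ex gb0 etr0 wfE.
exact: (definable_global_choice gb0 etr0 wfE beta0 _
  (X_definable_rel gb0 phi p) irr tr tot lmin rankU).
Qed.
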